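(* Let $A\in\mathbb{R}^{n\times n}$, $B\in\mathbb{R}^{n\times m}$, $C\in\mathbb{R}^{m\times n}$, $D\in\mathbb{R}^{m\times m}$, and let $P,S\in\mathbb{R}^{n\times n}$ satisfy $S^\top P=P^\top S$, $\operatorname{rank}\begin{bmatrix}P\\S\end{bmatrix}=n$, and the generalized dissipation inequality $$\begin{bmatrix} S^\top AP+P^\top A^\top S & S^\top B-P^\top C^\top\\ B^\top S-CP & -D-D^\top\end{bmatrix}\le 0 .$$ Then the controllable part (reachable subspace) $\operatorname{im}\begin{bmatrix}B&AB&\cdots&A^{n-1}B\end{bmatrix}$ of the system $\dot x=Ax+Bu$, $y=Cx+Du$ is contained in $\operatorname{im}P$. In particular, if $P$ is singular, then the system is not controllable.
   Context: For a symmetric real matrix $X$, $X\le 0$ means negative semidefinite. The system is controllable if $\operatorname{rank}\begin{bmatrix}B&AB&\cdots&A^{n-1}B\end{bmatrix}=n$. *)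

(* Defs.v *)
From mathcomp Require Import all_boot all_order all_algebra.
From mathcomp Require Import classical_sets reals.

Set Implicit Arguments.
Unset Strict Implicit.
Unset Printing Implicit Defensive.

Import Order.TTheory GRing.Theory Num.Theory.
Local Open Scope ring_scope.

Definition neg_semidef (R : realType) (k : nat) (X : 'M[R]_k) : Prop :=
  X^T = X /\ forall v : 'cV[R]_k, (v^T *m X *m v) 0 0 <= 0.

(* [im M] is the column space {M v}; MathComp's subspace order [(_ <= _)%MS]
   compares row spaces instead. *)
Definition im (R : realType) (p q : nat) (M : 'M[R]_(p, q)) : set 'cV[R]_p :=
  range (fun v : 'cV[R]_q => M *m v).

(* [B, A B, ..., A^(n-1) B], with n * m columns *)
Definition ctrb_mx (R : realType) (n m : nat)
    (A : 'M[R]_n) (B : 'M[R]_(n, m)) : 'M[R]_(n, \sum_(i < n) m) :=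
  \mxrow_(i < n) (A ^+ i *m B).

Definition controllable (R : realType) (n m : nat)
    (A : 'M[R]_n) (B : 'M[R]_(n, m)) : Prop :=
  \rank (ctrb_mx A B) = n.

Definition gen_dissip_mx (R : realType) (n m : nat)
    (A : 'M[R]_n) (B : 'M[R]_(n, m)) (C : 'M[R]_(m, n)) (D : 'M[R]_m)
    (P S : 'M[R]_n) : 'M[R]_(n + m) :=
  block_mx (S^T *m A *m P + P^T *m A^T *m S) (S^T *m B - P^T *m C^T)
           (B^T *m S - C *m P)               (- D - D^T).

(* Main.v *)
Require Import Defs.
From mathcomp Require Import all_boot all_order all_algebra.
From mathcomp Require Import classical_sets reals.
From mathcomp Require Import ring lra.

Set Implicit Arguments.
Unset Strict Implicit.
Unset Printing Implicit Defensive.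

Import Order.TTheory GRing.Theory Num.Theory.
Local Open Scope classical_set_scope.
Local Open Scope ring_scope.

(** Let K be the left kernel of P. Since S^T P = P^T S, the map S sends ker P
    into ker P^T, which is the space of transposes of K; it is injective on
    ker P by the rank condition, hence onto by equality of dimensions. For x in
    ker P the quadratic form of the dissipation matrix vanishes at (x, 0), so by
    semidefiniteness (x, 0) is in its kernel, i.e. P^T A^T S x = 0 and
    B^T S x = 0. Thus K is invariant under right multiplication by A and
    annihilates B, so K annihilates every A^i B, and the columns of the
    controllability matrix lie in im P. *)

Lemma mulmx_trv_eq0 (R : realDomainType) k (v : 'cV[R]_k) :
  (v^T *m v) 0 0 <= 0 -> v = 0.
Proof.
have sq_ge0 i : 0 <= v^T 0 i * v i 0 by rewrite mxE -expr2 sqr_ge0.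
rewrite mxE => le0; have /eqP : \sum_i v^T 0 i * v i 0 = 0.
  by apply/le_anti; rewrite le0 sumr_ge0.
rewrite psumr_eq0 // => /allP sq0; apply/matrixP => i j.
have := sq0 i (mem_index_enum i).
by rewrite !mxE (ord1 j) -expr2 sqrf_eq0 => /eqP.
Qed.

(** Along the line [v + t *: w] with [w = X *m v], the form equals [2 * t * a + t ^+ 2 * b]. It is
    nonpositive for every [t], so the linear coefficient, the squared norm [a] of [w], must
    vanish. *)
Lemma neg_semidef_ker (R : realType) k (X : 'M[R]_k) (v : 'cV[R]_k) :
  neg_semidef X -> (v^T *m X *m v) 0 0 = 0 -> X *m v = 0.
Proof.
move=> [symX nsdX] qv0; apply: mulmx_trv_eq0.
set w := X *m v; set a := (w^T *m w) 0 0; set b := (w^T *m X *m w) 0 0.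
have b_le0 : b <= 0 := nsdX w.
have vXw : v^T *m X *m w = w^T *m w.
  by rewrite {2}/w trmx_mul symX.
have wXv : w^T *m X *m v = w^T *m w by rewrite -mulmxA.
have quad t : 2 * t * a + t ^+ 2 * b <= 0.
  have := nsdX (v + t *: w).
  have -> : (v + t *: w)^T = v^T + t *: w^T by apply/matrixP => i j; rewrite !mxE.
  rewrite !mulmxDl !mulmxDr -!scalemxAl -!scalemxAr vXw wXv.
  have mxD (M N : 'M[R]_1) : (M + N) 0 0 = M 0 0 + N 0 0 by rewrite mxE.
  have mxZ c (M : 'M[R]_1) : (c *: M) 0 0 = c * M 0 0 by rewrite mxE.
  by rewrite !(mxD, mxZ) qv0 -/a -/b; lra.
rewrite leNgt; apply/negP => a_gt0.
(* Dividing by [1 - b] rather than [- b] also covers [b = 0]. *)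
have c_gt0 : 0 < 1 - b by lra.
have := quad (a / (1 - b)).
have -> : 2 * (a / (1 - b)) * a + (a / (1 - b)) ^+ 2 * b
  = a ^+ 2 * (2 - b) / (1 - b) ^+ 2 by field; rewrite gt_eqF.
by apply/negP; rewrite -ltNge divr_gt0 ?mulr_gt0 ?exprn_gt0 //; lra.
Qed.

Lemma lagrangian_kermx (F : fieldType) n (P S : 'M[F]_n) :
  S^T *m P = P^T *m S -> \rank (col_mx P S) = n ->
  (kermx P <= kermx P^T *m S^T)%MS.
Proof.
move=> hPS hrank.
have sub : (kermx P^T *m S^T <= kermx P)%MS.
  by apply/sub_kermxP; rewrite -mulmxA hPS mulmxA mulmx_ker mul0mx.
rewrite -(geq_leqif (mxrank_leqif_sup sub)).
have free : row_free (row_mx P^T S^T).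
  by rewrite /row_free -tr_col_mx mxrank_tr hrank.
(* Right multiplication by [S^T] is injective on [kermx P^T], so it preserves the rank. *)
have /mxrank_injP -> : (kermx P^T :&: kermx S^T)%MS == 0.
  rewrite -submx0; apply/rV_subP => u.
  rewrite sub_capmx => /andP[/sub_kermxP uP /sub_kermxP uS].
  by rewrite submx0 -(mulmx_free_eq0 _ free) mul_mx_row uP uS row_mx0.
by rewrite !mxrank_ker mxrank_tr.
Qed.

(** Column-space inclusion by duality: the rows of the transposed cokernel of [P^T] annihilate [P],
    hence [M]. *)
Lemma kermx0_submx (F : fieldType) n p q (P : 'M[F]_(n, p)) (M : 'M[F]_(n, q)) :
  (forall w : 'rV_n, w *m P = 0 -> w *m M = 0) -> (M^T <= P^T)%MS.
Proof.
move=> kerPM; rewrite submxE; apply/eqP/trmx_inj.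
rewrite trmx_mul trmxK trmx0; apply/row_matrixP => i.
rewrite row_mul row0; apply: kerPM.
by rewrite -row_mul -[P in _ *m P]trmxK -trmx_mul mulmx_coker trmx0 row0.
Qed.

Lemma gen_dissip_left_ker (R : realType) n m
    (A : 'M[R]_n) (B : 'M[R]_(n, m)) (C : 'M[R]_(m, n)) (D : 'M[R]_m)
    (P S : 'M[R]_n) (w : 'rV[R]_n) :
  S^T *m P = P^T *m S -> \rank (col_mx P S) = n ->
  neg_semidef (gen_dissip_mx A B C D P S) ->
  w *m P = 0 -> w *m A *m P = 0 /\ w *m B = 0.
Proof.
move=> hPS hrank hdiss /sub_kermxP wP.
have /submxP[z wE] := submx_trans wP (lagrangian_kermx hPS hrank).
set u := z *m kermx P^T.
have uP : u *m P^T = 0 by rewrite -mulmxA mulmx_ker mulmx0.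
have {wE} -> : w = u *m S^T by rewrite wE mulmxA.
have Pu : P *m u^T = 0 by rewrite -[P]trmxK -trmx_mul uP trmx0.
have symX := hdiss.1.
pose v := row_mx u (0 : 'rV_m).
(* The terms starting with [P^T] die against [u], leaving exactly [w *m A *m P] and [w *m B] for
   [w = u *m S^T]. *)
have vX : v *m gen_dissip_mx A B C D P S
  = row_mx (u *m S^T *m A *m P) (u *m S^T *m B).
  rewrite /v mul_row_block !mul0mx !addr0 mulmxDr mulmxBr !mulmxA uP.
  by rewrite !mul0mx addr0 subr0.
have /(congr1 trmx) : gen_dissip_mx A B C D P S *m v^T = 0.
  apply: neg_semidef_ker => //; rewrite trmxK vX tr_row_mx mul_row_col.
  by rewrite -[_ *m P *m _]mulmxA Pu trmx0 !mulmx0 addr0 mxE.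
rewrite trmx_mul trmxK symX vX trmx0 -(row_mx0 _ 1 n m).
by move/eq_row_mx.
Qed.

Lemma ctrb_mx_left_ker (R : realType) n m (A : 'M[R]_n) (B : 'M[R]_(n, m))
    p (P : 'M[R]_(n, p)) :
  (forall w : 'rV_n, w *m P = 0 -> w *m A *m P = 0 /\ w *m B = 0) ->
  forall w : 'rV_n, w *m P = 0 -> w *m ctrb_mx A B = 0.
Proof.
move=> inv w wP; rewrite /ctrb_mx mul_mxrow.
suff AiB0 i : w *m (A ^+ i *m B) = 0.
  by rewrite -mxrow0; apply/eq_mxrow => i; rewrite AiB0.
(* [w] stays general because the induction hypothesis is applied to [w *m A]. *)
elim: i w wP => [|i IHi] w wP; first by rewrite expr0 mul1mx (inv w wP).2.
by rewrite exprS -mulmxE -mulmxA mulmxA IHi // (inv w wP).1.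
Qed.

Theorem mainTheorem2 (R : realType) (n m : nat)
    (A : 'M[R]_n) (B : 'M[R]_(n, m)) (C : 'M[R]_(m, n)) (D : 'M[R]_m)
    (P S : 'M[R]_n)
    (hPS : S^T *m P = P^T *m S)
    (hrank : \rank (col_mx P S) = n)
    (hdiss : neg_semidef (gen_dissip_mx A B C D P S)) :
  im (ctrb_mx A B) `<=` im P /\
  (P \notin unitmx -> ~ controllable A B).
Proof.
have sub : ((ctrb_mx A B)^T <= P^T)%MS.
  apply/kermx0_submx/ctrb_mx_left_ker => w.
  exact: gen_dissip_left_ker hdiss.
split=> [_ [v _ <-]|Psing ctrl].
  have /submxP[X ctrbE] := sub; exists (X^T *m v) => //.
  by rewrite mulmxA -[P]trmxK -trmx_mul -ctrbE trmxK.
move/negP: Psing; apply.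
(* Controllability would give [P] rank at least [n]. *)
rewrite -row_full_unit -col_leq_rank -{1}ctrl -(mxrank_tr P) -mxrank_tr.
exact: mxrankS.
Qed.
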